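(* Let $T$ be a unital truss with universal ring $\mathrm{R}(T)$. The category of isotropic heaps of $T$-modules is equivalent to the full subcategory of the slice category of unital pointed $T$-modules over $\mathrm{R}(T)$ whose objects are all pairs $(G,\pi_G\colon G\to\mathrm{R}(T))$ with $\pi_G$ surjective, together with the pair $(\{0\},0\colon\{0\}\to\mathrm{R}(T))$.
   Context: An abelian heap is a (possibly empty) set $H$ with a ternary operation $[-,-,-]$ satisfying $[a,b,[c,d,e]]=[[a,b,c],d,e]$, $[a,b,b]=a=[b,b,a]$ and $[a,b,c]=[c,b,a]$; heap morphisms preserve the bracket. A truss is an abelian heap $T$ with an associative binary multiplication such that $t[s,s',s'']=[ts,ts',ts'']$ and $[s,s',s'']t=[st,s't,s''t]$; it is unital if it has a two-sided multiplicative identity $1_T$. Truss morphisms are multiplicative heap morphisms. Every ring $R$ yields a truss $\mathrm{T}(R)$ with the same multiplication and bracket $[a,b,c]=a-b+c$. The universal ring $\mathrm{R}(T)$ of a truss $T$ is a ring with a truss morphism $\iota_T\colon T\to \mathrm{T}(\mathrm{R}(T))$ such that every truss morphism $\varphi\colon T\to \mathrm{T}(R)$, $R$ a (not necessarily unital) ring, factors as $\varphi=\hat\varphi\circ\iota_T$ for a unique ring homomorphism $\hat\varphi\colon \mathrm{R}(T)\to R$. For $T$ unital, write $\mathrm{G}(T;1_T)$ for the abelian group on $T$ with addition $s+t=[s,1_T,t]$; then $\mathrm{R}(T)$ can be realised as $\mathrm{G}(T;1_T)\oplus\mathbb{Z}$ with $(t,m)(s,n)=(ts+(n-1)t+(m-1)s,\,mn)$,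 unit $(1_T,1)$ and $\iota_T(t)=(t,1)$. A left $T$-module is an abelian heap $M$ with an action $\cdot\colon T\times M\to M$ with $t\cdot(t'\cdot m)=(tt')\cdot m$, $[t,t',t'']\cdot m=[t\cdot m,t'\cdot m,t''\cdot m]$, $t\cdot[m,n,e]=[t\cdot m,t\cdot n,t\cdot e]$. A heap of $T$-modules is an abelian heap $M$ (possibly empty) with an operation $T\times M\times M\to M$, $(t,m,n)\mapsto t\triangleright_m n$, such that for each $m\in M$ the map $(t,n)\mapsto t\triangleright_m n$ makes $M$ a left $T$-module, and $t\triangleright_m n=[t\triangleright_e n,t\triangleright_e m,m]$ for all $m,n,e\in M$, $t\in T$. Morphisms are heap morphisms $f$ with $f(t\triangleright_m n)=t\triangleright_{f(m)}f(n)$. It is isotropic if $1_T\triangleright_m n=n$ for all $m,n\in M$; isotropic heaps of $T$-modules form a full subcategory. A unital pointed $T$-module is an abelian group $G$ with a map $\cdot\colon T\times G\to G$ such that $t\cdot(t'\cdot g)=(tt')\cdot g$, $[t,t',t'']\cdot g=t\cdot g-t'\cdot g+t''\cdot g$, $t\cdot(g+h)=t\cdot g+t\cdot h$ and $1_T\cdot g=g$. Morphisms are group homomorphisms $f$ with $f(t\cdot g)=t\cdot f(g)$. $\mathrm{R}(T)$ is a unital pointed $T$-module via $t\cdot r=\iota_T(t)r$. The slice category over $\mathrm{R}(T)$ has as objects pairs $(G,\pi_G)$ with $\pi_G\colon G\to\mathrm{R}(T)$ a morphism of unital pointed $T$-modules, and as morphisms $(G,\pi_G)\to(H,\pi_H)$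 those morphisms $f\colon G\to H$ with $\pi_H\circ f=\pi_G$. *)

(* Defs.v *)
From HB Require Import structures.
From mathcomp Require Import all_boot ssralg.
From mathcomp Require Import boolp.

Set Implicit Arguments.
Unset Strict Implicit.
Unset Printing Implicit Defensive.

Import GRing.Theory.
Local Open Scope ring_scope.

Record category := Category {
  obj :> Type;
  hom : obj -> obj -> Type;
  idc : forall X, hom X X;
  compc : forall X Y Z, hom Y Z -> hom X Y -> hom X Z;
  compcA : forall X Y Z W (h : hom Z W) (g : hom Y Z) (f : hom X Y),
    compc h (compc g f) = compc (compc h g) f;
  compc1l : forall X Y (f : hom X Y), compc (idc Y) f = f;
  compc1r : forall X Y (f : hom X Y), compc f (idc X) = f
}.
Arguments hom {c} : rename.
Arguments idc {c} : rename.
Arguments compc {c X Y Z} : rename.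

Record functor (C D : category) := Functor {
  fobj :> C -> D;
  fmap : forall X Y : C, hom X Y -> hom (fobj X) (fobj Y);
  fmap1 : forall X : C, fmap (idc X) = idc (fobj X);
  fmapM : forall (X Y Z : C) (g : hom Y Z) (f : hom X Y),
    fmap (compc g f) = compc (fmap g) (fmap f)
}.
Arguments fmap {C D} f {X Y} : rename.

Definition id_functor (C : category) : functor C C :=
  @Functor C C id (fun _ _ f => f) (fun _ => erefl) (fun _ _ _ _ _ => erefl).

Section CompFunctor.
Variables (C D E : category) (G : functor D E) (F : functor C D).

Lemma comp_functor1 (X : C) : fmap G (fmap F (idc X)) = idc (G (F X)).
Proof. by rewrite !fmap1. Qed.

Lemma comp_functorM (X Y Z : C) (g : hom Y Z) (f : hom X Y) :
  fmap G (fmap F (compc g f)) = compc (fmap G (fmap F g)) (fmap G (fmap F f)).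
Proof. by rewrite !fmapM. Qed.

Definition comp_functor : functor C E :=
  @Functor C E (fun X => G (F X)) (fun X Y f => fmap G (fmap F f))
    comp_functor1 comp_functorM.
End CompFunctor.

Record natural_iso (C D : category) (F G : functor C D) := NaturalIso {
  ni_to : forall X : C, hom (F X) (G X);
  ni_from : forall X : C, hom (G X) (F X);
  ni_natural : forall (X Y : C) (f : hom X Y),
    compc (ni_to Y) (fmap F f) = compc (fmap G f) (ni_to X);
  ni_fromK : forall X, compc (ni_to X) (ni_from X) = idc (G X);
  ni_toK : forall X, compc (ni_from X) (ni_to X) = idc (F X)
}.

Definition equivalent_categories (C D : category) : Prop :=
  exists (F : functor C D) (G : functor D C),
    inhabited (natural_iso (id_functor C) (comp_functor G F)) /\
    inhabited (natural_iso (comp_functor F G) (id_functor D)).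

Definition full_subcategory (C : category) (P : C -> Prop) : category :=
  @Category {X : C | P X} (fun X Y => hom (sval X) (sval Y))
    (fun X => idc (sval X)) (fun _ _ _ g f => compc g f)
    (fun _ _ _ _ => @compcA C _ _ _ _)
    (fun _ _ => @compc1l C _ _) (fun _ _ => @compc1r C _ _).

Section Slice.
Variables (C : category) (B : C).

Record slice_obj := SliceObj { slice_dom : C; slice_map : hom slice_dom B }.

Definition slice_hom (X Y : slice_obj) :=
  {f : hom (slice_dom X) (slice_dom Y) |
    compc (slice_map Y) f = slice_map X}.

Lemma slice_id_subproof (X : slice_obj) :
  compc (slice_map X) (idc (slice_dom X)) = slice_map X.
Proof. exact: compc1r. Qed.

Lemma slice_comp_subproof (X Y Z : slice_obj)
    (g : slice_hom Y Z) (f : slice_hom X Y) :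
  compc (slice_map Z) (compc (sval g) (sval f)) = slice_map X.
Proof. by rewrite compcA (svalP g) (svalP f). Qed.

Definition slice_id X : slice_hom X X := exist _ _ (slice_id_subproof X).
Definition slice_comp X Y Z (g : slice_hom Y Z) (f : slice_hom X Y) :
  slice_hom X Z := exist _ _ (slice_comp_subproof g f).

Lemma slice_hom_eq X Y (f g : slice_hom X Y) : sval f = sval g -> f = g.
Proof. by case: f g => [f ?] [g ?] /= ?; apply: eq_exist. Qed.

Definition slice : category.
refine (@Category slice_obj slice_hom slice_id slice_comp _ _ _).
- by move=> *; apply: slice_hom_eq; apply: compcA.
- by move=> *; apply: slice_hom_eq; apply: compc1l.
- by move=> *; apply: slice_hom_eq; apply: compc1r.
Defined.
End Slice.

Section ConcreteCategory.
Variables (O : Type) (carrier : O -> Type)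
  (mor : forall X Y : O, (carrier X -> carrier Y) -> Prop).
Hypothesis mor_id : forall X, mor (X := X) (Y := X) id.
Hypothesis mor_comp : forall X Y Z
  (g : carrier Y -> carrier Z) (f : carrier X -> carrier Y),
  mor g -> mor f -> mor (g \o f).

Definition concrete_hom X Y := {f : carrier X -> carrier Y | mor f}.

Lemma concrete_hom_eq X Y (f g : concrete_hom X Y) : sval f = sval g -> f = g.
Proof. by case: f g => [f ?] [g ?] /= ?; apply: eq_exist. Qed.

Definition concrete_category : category.
refine (@Category O concrete_hom (fun X => exist _ id (mor_id X))
  (fun X Y Z g f => exist _ _ (mor_comp (svalP g) (svalP f))) _ _ _);
  by move=> *; apply: concrete_hom_eq.
Defined.
End ConcreteCategory.

HB.mixin Record isAbelianHeap H := {
  br : H -> H -> H -> H;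
  brA : forall a b c d e, br a b (br c d e) = br (br a b c) d e;
  brKr : forall a b, br a b b = a;
  brKl : forall a b, br b b a = a;
  brC : forall a b c, br a b c = br c b a
}.

#[short(type="heapType")]
HB.structure Definition AbelianHeap := {H of Choice H & isAbelianHeap H}.

Definition heap_morphism (H K : heapType) (f : H -> K) : Prop :=
  forall a b c, f (br a b c) = br (f a) (f b) (f c).

HB.mixin Record Heap_Semigroup_isTruss T of AbelianHeap T & Semigroup T := {
  mulg_brr : forall t s s' s'' : T,
    (t * br s s' s'' = br (t * s) (t * s') (t * s''))%g;
  mulg_brl : forall s s' s'' t : T,
    (br s s' s'' * t = br (s * t) (s' * t) (s'' * t))%g
}.

#[short(type="trussType")]
HB.structure Definition Truss :=
  {T of AbelianHeap T & Semigroup T & Heap_Semigroup_isTruss T}.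

#[short(type="unitalTrussType")]
HB.structure Definition UnitalTruss := {T of Truss T & Monoid T}.

Definition truss_morphism (T S : trussType) (f : T -> S) : Prop :=
  heap_morphism f /\ (forall s t : T, f (s * t)%g = (f s * f t)%g).

(* The rings of [ssralg] are unital, so rings are here abelian groups carrying
   an associative bilinear multiplication, written [(x * y)%g]. *)

HB.mixin Record Zmodule_Semigroup_isRng R of GRing.Zmodule R & Semigroup R := {
  rng_mulDr : forall x y z : R, (x * (y + z)%R)%g = (x * y)%g + (x * z)%g;
  rng_mulDl : forall x y z : R, ((x + y)%R * z)%g = (x * z)%g + (y * z)%g
}.

#[short(type="rngType")]
HB.structure Definition Rng :=
  {R of GRing.Zmodule R & Semigroup R & Zmodule_Semigroup_isRng R}.

Definition rng_morphism (R S : rngType) (f : R -> S) : Prop :=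
  (forall x y, f (x + y) = f x + f y) /\
  (forall x y : R, f (x * y)%g = (f x * f y)%g).

Lemma rng_mulNr (R : rngType) (x y : R) : (x * (- y)%R)%g = - (x * y)%g.
Proof.
have x0 : (x * (0 : R))%g = 0 by apply: (addIr (x * 0)%g); rewrite -rng_mulDr !add0r.
by apply: (addIr (x * y)%g); rewrite -rng_mulDr !addNr.
Qed.

Lemma rng_mulNl (R : rngType) (x y : R) : ((- x)%R * y)%g = - (x * y)%g.
Proof.
have y0 : ((0 : R) * y)%g = 0 by apply: (addIr (0 * y)%g); rewrite -rng_mulDl !add0r.
by apply: (addIr (x * y)%g); rewrite -rng_mulDl !addNr.
Qed.

Definition truss_of_rng (R : rngType) : Type := R.

Section TrussOfRng.
Variable R : rngType.

Definition br_rng (a b c : R) : R := a - b + c.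

Lemma br_rngA a b c d e : br_rng a b (br_rng c d e) = br_rng (br_rng a b c) d e.
Proof. by rewrite /br_rng !addrA. Qed.

Lemma br_rngKr a b : br_rng a b b = a.
Proof. exact: subrK. Qed.

Lemma br_rngKl a b : br_rng b b a = a.
Proof. by rewrite /br_rng subrr add0r. Qed.

Lemma br_rngC a b c : br_rng a b c = br_rng c b a.
Proof. by rewrite /br_rng addrAC [a + c]addrC addrAC. Qed.

Lemma rng_mul_brr (t s s' s'' : R) :
  (t * br_rng s s' s'')%g = br_rng (t * s)%g (t * s')%g (t * s'')%g.
Proof. by rewrite /br_rng !rng_mulDr rng_mulNr. Qed.

Lemma rng_mul_brl (s s' s'' t : R) :
  (br_rng s s' s'' * t)%g = br_rng (s * t)%g (s' * t)%g (s'' * t)%g.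
Proof. by rewrite /br_rng !rng_mulDl rng_mulNl. Qed.

HB.instance Definition _ := Semigroup.on (truss_of_rng R).
HB.instance Definition _ :=
  isAbelianHeap.Build (truss_of_rng R) br_rngA br_rngKr br_rngKl br_rngC.
HB.instance Definition _ :=
  Heap_Semigroup_isTruss.Build (truss_of_rng R) rng_mul_brr rng_mul_brl.
End TrussOfRng.

(* [uring] is universal among not necessarily unital rings, and [phi_hat] is not
   required to preserve any unit. *)
Record universal_ring (T : trussType) := UniversalRing {
  uring :> rngType;
  uring_map : T -> uring;
  uring_map_morphism : truss_morphism (uring_map : T -> truss_of_rng uring);
  uring_univ : forall (S : rngType) (phi : T -> S),
    truss_morphism (phi : T -> truss_of_rng S) ->
    exists! phi_hat : uring -> S,
      rng_morphism phi_hat /\ phi = phi_hat \o uring_map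
}.
Arguments uring_map {T} u : rename.

Definition is_left_module (T : trussType) (M : heapType) (act : T -> M -> M) :=
  [/\ forall t t' m, act t (act t' m) = act (t * t')%g m,
      forall t t' t'' m, act (br t t' t'') m = br (act t m) (act t' m) (act t'' m)
    & forall t m n e, act t (br m n e) = br (act t m) (act t n) (act t e)].

(* [hact t m n] is the action of [t] on [n] based at [m]. *)
HB.mixin Record AbelianHeap_isHeapOfModules (T : trussType) M of AbelianHeap M := {
  hact : T -> M -> M -> M;
  hact_left_module : forall m, is_left_module (fun t n => hact t m n);
  hact_change : forall t m n e, hact t m n = br (hact t e n) (hact t e m) m
}.

#[short(type="heapOfModulesType")]
HB.structure Definition HeapOfModules (T : trussType) :=
  {M of AbelianHeap M & AbelianHeap_isHeapOfModules T M}.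

Definition heap_of_modules_morphism (T : trussType)
    (M N : heapOfModulesType T) (f : M -> N) : Prop :=
  heap_morphism f /\
  (forall (t : T) m n, f (hact t m n) = hact t (f m) (f n)).

Lemma heap_of_modules_morphism_id (T : trussType) (M : heapOfModulesType T) :
  heap_of_modules_morphism (id : M -> M).
Proof. by []. Qed.

Lemma heap_of_modules_morphism_comp (T : trussType)
    (M N P : heapOfModulesType T) (g : N -> P) (f : M -> N) :
  heap_of_modules_morphism g -> heap_of_modules_morphism f ->
  heap_of_modules_morphism (g \o f).
Proof.
move=> [gb ga] [fb fa]; split=> [a b c|t m n] /=; first by rewrite fb gb.
by rewrite fa ga.
Qed.

Definition heaps_of_modules (T : trussType) : category :=
  concrete_category (@heap_of_modules_morphism_id T)
    (@heap_of_modules_morphism_comp T).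

Definition isotropic (T : unitalTrussType) (M : heapOfModulesType T) : Prop :=
  forall m n : M, hact (1%g : T) m n = n.

Definition isotropic_heaps_of_modules (T : unitalTrussType) : category :=
  @full_subcategory (heaps_of_modules T) (@isotropic T).

HB.mixin Record Zmodule_isUnitalPointedModule (T : unitalTrussType) G
    of GRing.Zmodule G := {
  pact : T -> G -> G;
  pactA : forall t t' g, pact t (pact t' g) = pact (t * t')%g g;
  pact_br : forall t t' t'' g,
    pact (br t t' t'') g = pact t g - pact t' g + pact t'' g;
  pactD : forall t g h, pact t (g + h) = pact t g + pact t h;
  pact1 : forall g, pact 1%g g = g
}.

#[short(type="unitalPointedModuleType")]
HB.structure Definition UnitalPointedModule (T : unitalTrussType) :=
  {G of GRing.Zmodule G & Zmodule_isUnitalPointedModule T G}.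

Definition unital_pointed_module_morphism (T : unitalTrussType)
    (G H : unitalPointedModuleType T) (f : G -> H) : Prop :=
  (forall x y, f (x + y) = f x + f y) /\
  (forall (t : T) g, f (pact t g) = pact t (f g)).

Lemma unital_pointed_module_morphism_id (T : unitalTrussType)
    (G : unitalPointedModuleType T) :
  unital_pointed_module_morphism (id : G -> G).
Proof. by []. Qed.

Lemma unital_pointed_module_morphism_comp (T : unitalTrussType)
    (G H K : unitalPointedModuleType T) (g : H -> K) (f : G -> H) :
  unital_pointed_module_morphism g -> unital_pointed_module_morphism f ->
  unital_pointed_module_morphism (g \o f).
Proof.
move=> [gD ga] [fD fa]; split=> [x y|t x] /=; first by rewrite fD gD.
by rewrite fa ga.
Qed.

Definition unital_pointed_modules (T : unitalTrussType) : category :=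
  concrete_category (@unital_pointed_module_morphism_id T)
    (@unital_pointed_module_morphism_comp T).

Lemma pact0 (T : unitalTrussType) (G : unitalPointedModuleType T) (t : T) :
  pact t (0 : G) = 0.
Proof. by apply: (addIr (pact t (0 : G))); rewrite -pactD !add0r. Qed.

(* That [uring_map 1] is a left unit of the universal ring follows from
   uniqueness: [r |-> (r, 0)] and [r |-> (r, uring_map 1 * r - r)] are ring
   morphisms to [R * R] equipped with the product [(x, a) (y, b) = (xy, ay)],
   and they agree on the image of [uring_map]. *)

Definition twisted_square (R : rngType) : Type := (R * R)%type.

Section TwistedSquare.
Variable R : rngType.

Definition tw_mul (x y : twisted_square R) : twisted_square R :=
  ((x.1 * y.1)%g, (x.2 * y.1)%g).

Lemma tw_mulA : associative tw_mul.
Proof. by move=> x y z; rewrite /tw_mul /= !mulgA. Qed.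

HB.instance Definition _ := GRing.Zmodule.copy (twisted_square R) (R * R)%type.
HB.instance Definition _ := isSemigroup.Build (twisted_square R) tw_mulA.

Lemma tw_mulDr (x y z : twisted_square R) :
  (x * (y + z)%R)%g = (x * y)%g + (x * z)%g.
Proof. by congr pair; rewrite /= rng_mulDr. Qed.

Lemma tw_mulDl (x y z : twisted_square R) :
  ((x + y)%R * z)%g = (x * z)%g + (y * z)%g.
Proof. by congr pair; rewrite /= rng_mulDl. Qed.

HB.instance Definition _ :=
  Zmodule_Semigroup_isRng.Build (twisted_square R) tw_mulDr tw_mulDl.
End TwistedSquare.

Section UniversalRingModule.
Variables (T : unitalTrussType) (R : universal_ring T).
Local Notation iota := (uring_map R).

Lemma uring_map_br t t' t'' : iota (br t t' t'') = iota t - iota t' + iota t''.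
Proof. exact: (proj1 (uring_map_morphism R)). Qed.

Lemma uring_mapM t t' : iota (t * t')%g = (iota t * iota t')%g.
Proof. exact: (proj2 (uring_map_morphism R)). Qed.

Lemma uring_map1_mul (r : R) : (iota 1 * r)%g = r.
Proof.
pose S := twisted_square R.
pose phi (t : T) : S := (iota t, 0).
have mul0 (y : R) : ((0 : R) * y)%g = 0.
  by apply: (addIr (0 * y)%g); rewrite -rng_mulDl !add0r.
have phiM : truss_morphism (phi : T -> truss_of_rng S).
  split=> [a b c|s t].
    by congr pair; [exact: uring_map_br|rewrite /= subrr addr0].
  by congr pair; [exact: uring_mapM|exact/esym/mul0].
have [h [_ hU]] := uring_univ R phiM.
have h1 : h = fun r => (r, 0).
  apply: hU; split=> //; split=> x y; congr pair => //=.
  by rewrite addr0.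
have h2 : h = fun r => (r, (iota 1 * r)%g - r).
  apply: hU; split.
    split=> x y; congr pair => //=.
      by rewrite rng_mulDr opprD addrACA.
    by rewrite rng_mulDl rng_mulNl mulgA.
  apply: funext => t; congr pair => /=.
  by rewrite -uring_mapM mul1g subrr.
by have /(congr1 snd)/esym/eqP := congr1 (@^~ r) (etrans (esym h1) h2);
  rewrite /= subr_eq0 => /eqP.
Qed.

Definition uring_module : Type := R.

Definition uring_act (t : T) (r : R) : R := (iota t * r)%g.

Lemma uring_actA t t' r : uring_act t (uring_act t' r) = uring_act (t * t')%g r.
Proof. by rewrite /uring_act uring_mapM mulgA. Qed.

Lemma uring_act_br t t' t'' r :
  uring_act (br t t' t'') r = uring_act t r - uring_act t' r + uring_act t'' r.
Proof. by rewrite /uring_act uring_map_br !rng_mulDl rng_mulNl. Qed.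

Lemma uring_actD t r s : uring_act t (r + s) = uring_act t r + uring_act t s.
Proof. exact: rng_mulDr. Qed.

HB.instance Definition _ := GRing.Zmodule.on uring_module.
HB.instance Definition _ := Zmodule_isUnitalPointedModule.Build T uring_module
  uring_actA uring_act_br uring_actD uring_map1_mul.

Definition uring_object : unital_pointed_modules T := uring_module.
End UniversalRingModule.

Definition zero_group : Type := unit.

HB.instance Definition _ := Choice.on zero_group.

Definition zg_add (_ _ : zero_group) : zero_group := tt.
Definition zg_opp (_ : zero_group) : zero_group := tt.

Lemma zg_addA : associative zg_add. Proof. by []. Qed.
Lemma zg_addC : commutative zg_add. Proof. by []. Qed.
Lemma zg_add0 : left_id (tt : zero_group) zg_add. Proof. by case. Qed.
Lemma zg_addN : left_inverse (tt : zero_group) zg_opp zg_add. Proof. by []. Qed.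

HB.instance Definition _ :=
  GRing.isZmodule.Build zero_group zg_addA zg_addC zg_add0 zg_addN.

Definition zero_module (T : unitalTrussType) : Type := zero_group.

Section ZeroModuleInstance.
Variable T : unitalTrussType.

Definition zg_act (_ : T) (_ : zero_group) : zero_group := tt.

Lemma zg_actA t t' g : zg_act t (zg_act t' g) = zg_act (t * t')%g g.
Proof. by []. Qed.
Lemma zg_act_br t t' t'' g :
  zg_act (br t t' t'') g = zg_act t g - zg_act t' g + zg_act t'' g.
Proof. by []. Qed.
Lemma zg_actD t g h : zg_act t (g + h) = zg_act t g + zg_act t h.
Proof. by []. Qed.
Lemma zg_act1 g : zg_act 1%g g = g.
Proof. by case: g. Qed.

HB.instance Definition _ := GRing.Zmodule.on (zero_module T).
HB.instance Definition _ := Zmodule_isUnitalPointedModule.Build T (zero_module T)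
  zg_actA zg_act_br zg_actD zg_act1.
End ZeroModuleInstance.

Section SliceOverUniversalRing.
Variables (T : unitalTrussType) (R : universal_ring T).

Lemma zero_map_subproof : @unital_pointed_module_morphism T
  (zero_module T) (uring_module R) (fun=> 0).
Proof. by split=> [x y|t g]; rewrite ?addr0 ?pact0. Qed.

Definition slice_over_uring : category := slice (uring_object R).

Definition zero_over_uring : slice_over_uring :=
  @SliceObj (unital_pointed_modules T) (uring_object R)
    (zero_module T) (exist _ _ zero_map_subproof).

Definition surjective_over_uring (X : slice_over_uring) : Prop :=
  forall r : R, exists g : slice_dom X, sval (slice_map X) g = r.

Definition surjective_or_zero : category :=
  full_subcategory
    (fun X : slice_over_uring => surjective_over_uring X \/ X = zero_over_uring).
End SliceOverUniversalRing.

(* Main.v *)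
(** Each [(G, pi)] over the universal ring is sent to its fibre
    [M = pi^-1(iota 1)], with bracket [a - b + c] and
    [t |>_m n = t n - t m + m].  This functor is an equivalence.

    Every pointed module is an [R]-module, and [R] is additively generated by
    the image of [iota], so module morphisms are [R]-linear.  For [e] in [M],
    each [g] in [G] is [(g - pi(g) e + e) - e + pi(g) e], where the first term
    lies in [M]: a morphism over [R] is thus determined by its restriction to
    the fibres, and a morphism [h] of fibres extends by
    [g |-> h(g - pi(g) e + e) - h(e) + pi(g) h(e)].  A nonempty isotropic [M]
    is the fibre of the projection [M_e * R -> R], where [M_e] is [M] with
    zero [e].  As [iota 1 <> 0], the empty heap is the fibre of the zero
    object. *)

From HB Require Import structures.
From mathcomp Require Import all_boot ssralg.
From mathcomp Require Import boolp.
Require Import Defs.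

Set Implicit Arguments.
Unset Strict Implicit.
Unset Printing Implicit Defensive.

Import GRing.Theory.
Local Open Scope ring_scope.

(** * Fully faithful, essentially surjective functors are equivalences *)

Definition faithful (C D : category) (F : functor C D) : Prop :=
  forall (X Y : C) (f g : hom X Y), fmap F f = fmap F g -> f = g.

Definition full (C D : category) (F : functor C D) : Prop :=
  forall (X Y : C) (h : hom (F X) (F Y)), exists f : hom X Y, fmap F f = h.

Definition essentially_surjective (C D : category) (F : functor C D) : Prop :=
  forall Y : D, exists (X : C) (u : hom Y (F X)) (v : hom (F X) Y),
    compc u v = idc (F X) /\ compc v u = idc Y.

Section WeakInverse.
Variables (C D : category) (F : functor C D).
Hypotheses (F_faithful : faithful F) (F_full : full F)
  (F_esurj : essentially_surjective F).

Let lift (X Y : C) (h : hom (F X) (F Y)) : hom X Y := projT1 (cid (F_full h)).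

Let liftK (X Y : C) (h : hom (F X) (F Y)) : fmap F (lift h) = h.
Proof. exact: projT2 (cid (F_full h)). Qed.

Let winv (Y : D) : C := projT1 (cid (F_esurj Y)).

Let unit_ex (Y : D) := cid (projT2 (cid (F_esurj Y))).
Let unit (Y : D) : hom Y (F (winv Y)) := projT1 (unit_ex Y).
Let unitV (Y : D) : hom (F (winv Y)) Y := projT1 (cid (projT2 (unit_ex Y))).

Let unitKV (Y : D) : compc (unit Y) (unitV Y) = idc (F (winv Y)).
Proof. exact: (proj1 (projT2 (cid (projT2 (unit_ex Y))))). Qed.

Let unitVK (Y : D) : compc (unitV Y) (unit Y) = idc Y.
Proof. exact: (proj2 (projT2 (cid (projT2 (unit_ex Y))))). Qed.

(** Conjugating by the chosen isomorphisms turns [f] into a map between objects in the image of [F],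
    which fullness lifts. Faithfulness then reduces functoriality to identities in [D]. *)
Let wmap (X Y : D) (f : hom X Y) : hom (winv X) (winv Y) :=
  lift (compc (unit Y) (compc f (unitV X))).

Let wmap1 (X : D) : wmap (idc X) = idc (winv X).
Proof. by apply: F_faithful; rewrite liftK fmap1 compc1l unitKV. Qed.

Let wmapM (X Y Z : D) (g : hom Y Z) (f : hom X Y) :
  wmap (compc g f) = compc (wmap g) (wmap f).
Proof.
apply: F_faithful; rewrite fmapM !liftK -!compcA; congr compc; congr compc.
by rewrite [RHS]compcA unitVK compc1l.
Qed.

Let W : functor D C := Functor wmap1 wmapM.

Lemma equivalent_of_weak_inverse : equivalent_categories D C.
Proof.
exists W, F; split; constructor.
  exists unit unitV => // X Y f.
  by rewrite /= liftK -!compcA unitVK compc1r.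
(* At [F X] both isomorphisms run between objects in the image of [F], so they lift to mutually
   inverse maps in [C]. *)
exists (fun X => lift (unitV (F X))) (fun X => lift (unit (F X))).
- move=> X Y f; apply: F_faithful; rewrite /= !fmapM !liftK.
  by rewrite compcA unitVK compc1l.
- by move=> X; apply: F_faithful; rewrite fmapM !liftK fmap1 unitVK.
- by move=> X; apply: F_faithful; rewrite fmapM !liftK fmap1 unitKV.
Qed.
End WeakInverse.

(** * The endomorphism ring of an abelian group *)

Definition additive_endo (G : zmodType) : Type :=
  {f : G -> G | forall x y, f (x + y) = f x + f y}.

Section AdditiveEndo.
Variable G : zmodType.
Local Notation E := (additive_endo G).

HB.instance Definition _ := gen_eqMixin E.
HB.instance Definition _ := gen_choiceMixin E.

Lemma additive_endo_eq (f g : E) : sval f =1 sval g -> f = g.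
Proof. by move=> /funext; case: f g => [f ?] [g ?] /= ?; apply: eq_exist. Qed.

Lemma endo_add_subproof (f g : E) x y :
  sval f (x + y) + sval g (x + y) = sval f x + sval g x + (sval f y + sval g y).
Proof. by rewrite (svalP f) (svalP g) addrACA. Qed.
Lemma endo_opp_subproof (f : E) x y :
  - sval f (x + y) = - sval f x + - sval f y.
Proof. by rewrite (svalP f) opprD. Qed.
Lemma endo_zero_subproof (x y : G) : 0 = 0 + 0 :> G.
Proof. by rewrite addr0. Qed.
Lemma endo_mul_subproof (f g : E) x y :
  sval f (sval g (x + y)) = sval f (sval g x) + sval f (sval g y).
Proof. by rewrite (svalP g) (svalP f). Qed.

Definition endo_add (f g : E) : E := exist _ _ (endo_add_subproof f g).
Definition endo_opp (f : E) : E := exist _ _ (endo_opp_subproof f).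
Definition endo_zero : E := exist _ _ endo_zero_subproof.
Definition endo_mul (f g : E) : E := exist _ _ (endo_mul_subproof f g).

Lemma endo_addA : associative endo_add.
Proof. by move=> f g h; apply: additive_endo_eq => x /=; rewrite addrA. Qed.
Lemma endo_addC : commutative endo_add.
Proof. by move=> f g; apply: additive_endo_eq => x /=; rewrite addrC. Qed.
Lemma endo_add0 : left_id endo_zero endo_add.
Proof. by move=> f; apply: additive_endo_eq => x /=; rewrite add0r. Qed.
Lemma endo_addN : left_inverse endo_zero endo_opp endo_add.
Proof. by move=> f; apply: additive_endo_eq => x /=; rewrite addNr. Qed.
HB.instance Definition _ :=
  GRing.isZmodule.Build E endo_addA endo_addC endo_add0 endo_addN.

Lemma endo_mulA : associative endo_mul.
Proof. by move=> f g h; apply: additive_endo_eq. Qed.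
HB.instance Definition _ := isSemigroup.Build E endo_mulA.

Lemma endo_mulDr (f g h : E) : (f * (g + h)%R)%g = (f * g)%g + (f * h)%g.
Proof. by apply: additive_endo_eq => x /=; rewrite (svalP f). Qed.
Lemma endo_mulDl (f g h : E) : ((f + g)%R * h)%g = (f * h)%g + (g * h)%g.
Proof. exact: additive_endo_eq. Qed.
HB.instance Definition _ :=
  Zmodule_Semigroup_isRng.Build E endo_mulDr endo_mulDl.
End AdditiveEndo.

(* The two-element field: mapping [T] to its unit shows [iota 1 <> 0]. *)
Definition rng_bool : Type := bool.

HB.instance Definition _ := GRing.Zmodule.copy rng_bool bool.
HB.instance Definition _ := isSemigroup.Build rng_bool andbA.

Lemma rng_bool_mulDr (x y z : rng_bool) :
  (x * (y + z)%R)%g = (x * y)%g + (x * z)%g.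
Proof. by case: x y z => [] [] []. Qed.
Lemma rng_bool_mulDl (x y z : rng_bool) :
  ((x + y)%R * z)%g = (x * z)%g + (y * z)%g.
Proof. by case: x y z => [] [] []. Qed.
HB.instance Definition _ :=
  Zmodule_Semigroup_isRng.Build rng_bool rng_bool_mulDr rng_bool_mulDl.

(** * The universal ring: generation by [iota] and action on pointed modules *)

Section UniversalRingTheory.
Variables (T : unitalTrussType) (R : universal_ring T).
Local Notation iota := (uring_map R).

Lemma uring_map1_neq0 : iota 1%g <> 0.
Proof.
pose phi (_ : T) : rng_bool := true.
have phiM : truss_morphism (phi : T -> truss_of_rng rng_bool) by [].
have [h [[[hD _] hphi] _]] := uring_univ R phiM.
have h0 : h 0 = 0 by apply: (addIr (h 0)); rewrite -hD !add0r.
by move=> i0; have := congr1 (@^~ 1%g) hphi; rewrite /= i0 h0.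
Qed.

(** The additive subgroup generated by the image of [iota]. Closure under subtraction alone already
    yields zero, opposites and sums, and leaves only two cases in inductions. *)
Inductive iota_span : R -> Prop :=
  | iota_span_map t : iota_span (iota t)
  | iota_span_sub x y : iota_span x -> iota_span y -> iota_span (x - y).

Lemma iota_span0 : iota_span 0.
Proof. by rewrite -(subrr (iota 1%g)); do 2?constructor. Qed.

Lemma iota_spanN x : iota_span x -> iota_span (- x).
Proof. by rewrite -sub0r => ?; constructor=> //; apply: iota_span0. Qed.

Lemma iota_spanD x y : iota_span x -> iota_span y -> iota_span (x + y).
Proof.
by move=> ? ?; rewrite -[y]opprK; constructor=> //; apply: iota_spanN.
Qed.

(** The image of [iota] is closed under products, so by bilinearity its additive span is a
    subring. *)
Lemma iota_spanM x y : iota_span x -> iota_span y -> iota_span (x * y)%g.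
Proof.
elim=> [t|x1 x2 _ IH1 _ IH2] Hy; last first.
  by rewrite rng_mulDl rng_mulNl; constructor; [apply: IH1|apply: IH2].
elim: Hy => [s|y1 y2 _ IH1 _ IH2].
  by rewrite -uring_mapM; constructor.
by rewrite rng_mulDr rng_mulNr; constructor.
Qed.

Definition iota_subrng : Type := {x : R | iota_span x}.
Local Notation S := iota_subrng.

HB.instance Definition _ := gen_eqMixin S.
HB.instance Definition _ := gen_choiceMixin S.

Lemma iota_subrng_eq (x y : S) : sval x = sval y -> x = y.
Proof. by case: x y => [x ?] [y ?] /= ?; apply: eq_exist. Qed.

Definition isr_add (x y : S) : S := exist _ _ (iota_spanD (svalP x) (svalP y)).
Definition isr_opp (x : S) : S := exist _ _ (iota_spanN (svalP x)).
Definition isr_zero : S := exist _ _ iota_span0.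
Definition isr_mul (x y : S) : S := exist _ _ (iota_spanM (svalP x) (svalP y)).

Lemma isr_addA : associative isr_add.
Proof. by move=> x y z; apply: iota_subrng_eq; apply: addrA. Qed.
Lemma isr_addC : commutative isr_add.
Proof. by move=> x y; apply: iota_subrng_eq; apply: addrC. Qed.
Lemma isr_add0 : left_id isr_zero isr_add.
Proof. by move=> x; apply: iota_subrng_eq; apply: add0r. Qed.
Lemma isr_addN : left_inverse isr_zero isr_opp isr_add.
Proof. by move=> x; apply: iota_subrng_eq; apply: addNr. Qed.
HB.instance Definition _ :=
  GRing.isZmodule.Build S isr_addA isr_addC isr_add0 isr_addN.

Lemma isr_mulA : associative isr_mul.
Proof. by move=> x y z; apply: iota_subrng_eq; apply: mulgA. Qed.
HB.instance Definition _ := isSemigroup.Build S isr_mulA.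

Lemma isr_mulDr (x y z : S) : (x * (y + z)%R)%g = (x * y)%g + (x * z)%g.
Proof. by apply: iota_subrng_eq; apply: rng_mulDr. Qed.
Lemma isr_mulDl (x y z : S) : ((x + y)%R * z)%g = (x * z)%g + (y * z)%g.
Proof. by apply: iota_subrng_eq; apply: rng_mulDl. Qed.
HB.instance Definition _ :=
  Zmodule_Semigroup_isRng.Build S isr_mulDr isr_mulDl.

(* [R -> S -> R] and the identity both extend [iota], hence coincide. *)
Lemma iota_spanT (r : R) : iota_span r.
Proof.
pose phi (t : T) : S := exist _ _ (iota_span_map t).
have phiM : truss_morphism (phi : T -> truss_of_rng S).
  split=> [a b c|s t]; apply: iota_subrng_eq => /=.
    exact: uring_map_br.
  exact: uring_mapM.
have [h [[[hD hM] hphi] _]] := uring_univ R phiM.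
have [k [_ kU]] := uring_univ R (uring_map_morphism R).
have k1 : k = id by apply: kU.
have k2 : k = fun x => sval (h x).
  apply: kU; split; last first.
    by apply: funext => t; have := congr1 (@^~ t) hphi => /= <-.
  by split=> x y; rewrite ?hD ?hM.
have -> : r = sval (h r) by rewrite -[LHS]/(id r) -k1 k2.
exact: svalP.
Qed.

(** Right multiplication by [iota 1] is additive and fixes the generators [iota t]. *)
Lemma uring_mul_map1 (r : R) : (r * iota 1)%g = r.
Proof.
elim: (iota_spanT r) => [t|x y _ IHx _ IHy]; first by rewrite -uring_mapM mulg1.
by rewrite rng_mulDl rng_mulNl IHx IHy.
Qed.

Section Action.
Variable G : unitalPointedModuleType T.

(** The map [t |-> pact t] is a truss morphism into the endomorphism ring of [G], and the universal
    property extends it to [R]. *)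
Lemma uring_action_ex : exists h : R -> additive_endo G,
  rng_morphism h /\ forall t g, sval (h (iota t)) g = pact t g.
Proof.
pose phi (t : T) : additive_endo G := exist _ (pact t) (pactD t).
have phiM : truss_morphism (phi : T -> truss_of_rng (additive_endo G)).
  split=> [a b c|s t]; apply: additive_endo_eq => x /=.
    by rewrite pact_br.
  by rewrite pactA.
have [h [[hM hphi] _]] := uring_univ R phiM.
by exists h; split=> // t g; have := congr1 (@^~ t) hphi => /= <-.
Qed.

Definition ract (r : R) (g : G) : G := sval (projT1 (cid uring_action_ex) r) g.

Lemma ract_map t g : ract (iota t) g = pact t g.
Proof. exact: (proj2 (projT2 (cid uring_action_ex))). Qed.

Lemma ractDl r s g : ract (r + s) g = ract r g + ract s g.
Proof.
rewrite /ract; case: (cid _) => h [[hD _] _] /=.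
by rewrite hD.
Qed.

Lemma ractM r s g : ract (r * s)%g g = ract r (ract s g).
Proof.
rewrite /ract; case: (cid _) => h [[_ hM] _] /=.
by rewrite hM.
Qed.

Lemma ractBl r s g : ract (r - s) g = ract r g - ract s g.
Proof. by apply: (addIr (ract s g)); rewrite -ractDl !subrK. Qed.

End Action.

Section Morphism.
Variables (G H : unitalPointedModuleType T) (f : G -> H).
Hypothesis fM : unital_pointed_module_morphism f.

Lemma upm_morphB x y : f (x - y) = f x - f y.
Proof. by apply: (addIr (f y)); rewrite -(proj1 fM) !subrK. Qed.

Lemma upm_morph0 : f 0 = 0.
Proof. by rewrite -(subrr (0 : G)) upm_morphB subrr. Qed.

Lemma upm_morph_ract r g : f (ract r g) = ract r (f g).
Proof.
elim: (iota_spanT r) => [t|x y _ IHx _ IHy].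
  by rewrite !ract_map (proj2 fM).
by rewrite !ractBl upm_morphB IHx IHy.
Qed.
End Morphism.

(** With [upm_morph_ract], this turns [pi (ract r g)] into the product of [r] and [pi g]. *)
Lemma ract_uring (r s : R) : ract r (s : uring_module R) = (r * s)%g.
Proof.
elim: (iota_spanT r) => [t|x y _ IHx _ IHy]; first by rewrite ract_map.
by rewrite ractBl rng_mulDl rng_mulNl IHx IHy.
Qed.

End UniversalRingTheory.

(** * The fibre over [iota 1] as an isotropic heap of modules *)

Lemma subr_shift (V : zmodType) (x y m : V) : (x + m) - (y + m) = x - y.
Proof. by rewrite opprD addrACA subrr addr0. Qed.

Lemma bracket_addr (V : zmodType) (x y z m : V) :
  (x + m) - (y + m) + (z + m) = x - y + z + m.
Proof. by rewrite subr_shift addrA. Qed.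

Lemma pactB (T : unitalTrussType) (G : unitalPointedModuleType T) t (x y : G) :
  pact t (x - y) = pact t x - pact t y.
Proof. by apply: (addIr (pact t y)); rewrite -pactD !subrK. Qed.

Section Fibre.
Variables (T : unitalTrussType) (R : universal_ring T).
Variable G : unitalPointedModuleType T.
Variable p : {f : G -> uring_module R | unital_pointed_module_morphism f}.
Local Notation iota := (uring_map R).
Local Notation pi := (sval p).

(** The boolean equation makes membership proofs irrelevant and lets the fibre inherit the choice
    structure of [G]. *)
Definition fibre : Type := {g : G | pi g == iota 1%g}.
HB.instance Definition _ := Choice.on fibre.

Lemma fibreP (a : fibre) : pi (sval a) = iota 1%g.
Proof. exact/eqP/(svalP a). Qed.

Lemma fibre_eq (a b : fibre) : sval a = sval b -> a = b.
Proof. exact: val_inj. Qed.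

Lemma fibre_br_subproof (a b c : fibre) :
  pi (sval a - sval b + sval c) == iota 1%g.
Proof. by rewrite (proj1 (svalP p)) (upm_morphB (svalP p)) !fibreP subrK. Qed.

(** [pi] sends both [t n] and [t m] to [t] acting on [iota 1], so their difference lies in the
    kernel and adding [m] returns to the fibre. *)
Lemma fibre_act_subproof t (m n : fibre) :
  pi (pact t (sval n) - pact t (sval m) + sval m) == iota 1%g.
Proof.
rewrite (proj1 (svalP p)) (upm_morphB (svalP p)) !(proj2 (svalP p)) !fibreP.
by rewrite subrr add0r.
Qed.

Definition fibre_br (a b c : fibre) : fibre :=
  exist (fun g => pi g == iota 1%g) _ (fibre_br_subproof a b c).
Definition fibre_act t (m n : fibre) : fibre :=
  exist (fun g => pi g == iota 1%g) _ (fibre_act_subproof t m n).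

Lemma fibre_brA a b c d e :
  fibre_br a b (fibre_br c d e) = fibre_br (fibre_br a b c) d e.
Proof. by apply: fibre_eq; rewrite /= !addrA. Qed.
Lemma fibre_brKr a b : fibre_br a b b = a.
Proof. by apply: fibre_eq; rewrite /= subrK. Qed.
Lemma fibre_brKl a b : fibre_br b b a = a.
Proof. by apply: fibre_eq; rewrite /= subrr add0r. Qed.
Lemma fibre_brC a b c : fibre_br a b c = fibre_br c b a.
Proof. by apply: fibre_eq; rewrite /= addrAC [X in X - _]addrC addrAC. Qed.
HB.instance Definition _ :=
  isAbelianHeap.Build fibre fibre_brA fibre_brKr fibre_brKl fibre_brC.

Lemma fibre_act_module m : is_left_module (fun t n => fibre_act t m n).
Proof.
split=> [t t' n|t t' t'' n|t n k e]; apply: fibre_eq => /=.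
(* Expanding [t (t' n - t' m + m)] produces a [t m] that cancels the subtracted one. *)
- by rewrite pactD pactB !pactA addrK.
- rewrite !pact_br bracket_addr opprD addrACA; congr (_ + _ + _).
  by rewrite !opprD addrACA.
- by rewrite pactD pactB !bracket_addr.
Qed.
(** The shift [- t e + e] occurs in the first two arguments of the bracket and cancels. *)
Lemma fibre_act_change t m n e :
  fibre_act t m n = br (fibre_act t e n) (fibre_act t e m) m.
Proof. by apply: fibre_eq; rewrite /= !subr_shift. Qed.
HB.instance Definition _ :=
  AbelianHeap_isHeapOfModules.Build T fibre fibre_act_module fibre_act_change.

Lemma fibre_isotropic : isotropic (fibre : heapOfModulesType T).
Proof. by move=> m n; apply: fibre_eq; rewrite /= !pact1 subrK. Qed.
End Fibre.

(** * The pointed module of a heap of modules at a base point *)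

Section PointedAt.
Variables (T : unitalTrussType) (M : heapOfModulesType T).
Hypothesis M_iso : isotropic M.
Variable e : M.

(* The alias records [M_iso] and [e], on which the instances below depend. *)
Definition pointed_at : Type := let _ := (M_iso, e) in M.
Local Notation P := pointed_at.
HB.instance Definition _ := Choice.copy P M.

(** The retract of the heap at [e]: the abelian group with zero [e]. *)
Definition pt_add (a b : P) : P := br (a : M) e b.
Definition pt_opp (a : P) : P := br e (a : M) e.
Definition pt_act (t : T) (a : P) : P := hact t e (a : M).

Lemma pt_addA : associative pt_add.
Proof. by move=> a b c; apply: brA. Qed.
Lemma pt_addC : commutative pt_add.
Proof. by move=> a b; apply: brC. Qed.
Lemma pt_add0 : left_id (e : P) pt_add.
Proof. by move=> a; apply: brKl. Qed.
Lemma pt_addN : left_inverse (e : P) pt_opp pt_add.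
Proof. by move=> a; rewrite /pt_add /pt_opp -brA brKl brKr. Qed.
HB.instance Definition _ :=
  GRing.isZmodule.Build P pt_addA pt_addC pt_add0 pt_addN.

(** Since [- b] is [[e, b, e]], associativity and cancellation remove every [e]: the bracket is
    recovered from the retract, whatever the base point. *)
Lemma pt_brE (a b c : M) : br a b c = (a : P) - (b : P) + (c : P).
Proof.
by rewrite /GRing.add /GRing.opp /= /pt_add /pt_opp brA brKr -brA brKl.
Qed.

(** Changing the base from [e] to itself gives a bracket [[x, x, e]]. The action thus fixes the zero
    of the retract, which [pt_actD] needs. *)
Lemma hact_base t : hact t e e = e.
Proof. by rewrite (hact_change t e e e) brKl. Qed.

Lemma pt_actA t t' a : pt_act t (pt_act t' a) = pt_act (t * t')%g a.
Proof. by case: (hact_left_module (s := M) e) => + _ _; apply. Qed.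
Lemma pt_act_br t t' t'' a :
  pt_act (br t t' t'') a = pt_act t a - pt_act t' a + pt_act t'' a.
Proof.
by case: (hact_left_module (s := M) e) => _ H _; rewrite -pt_brE; apply: H.
Qed.
Lemma pt_actD t a b : pt_act t (a + b) = pt_act t a + pt_act t b.
Proof.
case: (hact_left_module (s := M) e) => _ _ H.
by rewrite /pt_act [LHS]H hact_base.
Qed.
(** Isotropy at the base [e] is the unit law. *)
HB.instance Definition _ := Zmodule_isUnitalPointedModule.Build T P
  pt_actA pt_act_br pt_actD (M_iso e).
End PointedAt.

(** * Products of pointed modules *)

Section ProductModule.
Variables (T : unitalTrussType) (G H : unitalPointedModuleType T).

Definition prod_module : Type := (G * H)%type.
HB.instance Definition _ := GRing.Zmodule.copy prod_module (G * H)%type.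

Definition prod_act (t : T) (x : prod_module) : prod_module :=
  (pact t x.1, pact t x.2).

Lemma prod_actA t t' x : prod_act t (prod_act t' x) = prod_act (t * t')%g x.
Proof. by rewrite /prod_act !pactA. Qed.
Lemma prod_act_br t t' t'' x :
  prod_act (br t t' t'') x = prod_act t x - prod_act t' x + prod_act t'' x.
Proof. by congr pair; rewrite /= pact_br. Qed.
Lemma prod_actD t x y : prod_act t (x + y) = prod_act t x + prod_act t y.
Proof. by congr pair; rewrite /= pactD. Qed.
Lemma prod_act1 x : prod_act 1%g x = x.
Proof. by case: x => x y; rewrite /prod_act !pact1. Qed.
HB.instance Definition _ := Zmodule_isUnitalPointedModule.Build T prod_module
  prod_actA prod_act_br prod_actD prod_act1.

Lemma snd_morphism : unital_pointed_module_morphism (snd : prod_module -> H).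
Proof. by []. Qed.
End ProductModule.

(** * The fibre functor *)

Section FibreFunctor.
Variables (T : unitalTrussType) (R : universal_ring T).
Local Notation iota := (uring_map R).

Definition fibre_object (X : surjective_or_zero R) :
    isotropic_heaps_of_modules T :=
  exist _ (fibre (slice_map (sval X)) : heapOfModulesType T)
    (@fibre_isotropic T R _ (slice_map (sval X))).

Section Map.
Variables (X Y : surjective_or_zero R) (f : hom X Y).

Lemma slice_hom_map (x : slice_dom (sval X)) :
  sval (slice_map (sval Y)) (sval (sval f) x) = sval (slice_map (sval X)) x.
Proof. exact: (congr1 (fun h => sval h x) (svalP f)). Qed.

Lemma fibre_map_subproof (a : fibre (slice_map (sval X))) :
  sval (slice_map (sval Y)) (sval (sval f) (sval a)) == iota 1%g.
Proof. by rewrite slice_hom_map; apply: (svalP a). Qed.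

Definition fibre_map (a : fibre (slice_map (sval X))) :
    fibre (slice_map (sval Y)) :=
  exist (fun g => sval (slice_map (sval Y)) g == iota 1%g) _
    (fibre_map_subproof a).

Lemma fibre_map_morphism : heap_of_modules_morphism fibre_map.
Proof.
have fM := svalP (sval f).
split=> [a b c|t m n]; apply: fibre_eq => /=.
  by rewrite (proj1 fM) (upm_morphB fM).
by rewrite (proj1 fM) (upm_morphB fM) !(proj2 fM).
Qed.
End Map.

Definition fibre_fmap (X Y : surjective_or_zero R) (f : hom X Y) :
  hom (fibre_object X) (fibre_object Y) := exist _ _ (fibre_map_morphism f).

Lemma fibre_fmap1 X : fibre_fmap (idc X) = idc (fibre_object X).
Proof. by apply: concrete_hom_eq; apply: funext => a; apply: fibre_eq. Qed.

Lemma fibre_fmapM X Y Z (g : hom Y Z) (f : hom X Y) :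
  fibre_fmap (compc g f) = compc (fibre_fmap g) (fibre_fmap f).
Proof. by apply: concrete_hom_eq; apply: funext => a; apply: fibre_eq. Qed.

Definition fibre_functor :
    functor (surjective_or_zero R) (isotropic_heaps_of_modules T) :=
  Functor fibre_fmap1 fibre_fmapM.
End FibreFunctor.

(** * The fibre functor is faithful, full and essentially surjective *)

Section Equivalence.
Variables (T : unitalTrussType) (R : universal_ring T).
Local Notation iota := (uring_map R).
Local Notation Fib := (fibre_functor R).

Section Decomposition.
Variables (G : unitalPointedModuleType T)
  (p : {f : G -> uring_module R | unital_pointed_module_morphism f}).
Variable e : fibre p.
Local Notation pi := (sval p).

(** Linearity and the right unit law give [pi (pi(g) e) = pi(g) * iota 1 = pi(g)], so only
    [pi e = iota 1] remains. *)
Lemma fibre_shift_subproof (g : G) :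
  pi (g - ract (pi g) (sval e) + sval e) == iota 1%g.
Proof.
have pM := svalP p.
rewrite (proj1 pM) (upm_morphB pM) (upm_morph_ract pM) fibreP.
by rewrite ract_uring uring_mul_map1 subrr add0r.
Qed.

Definition fibre_shift (g : G) : fibre p :=
  exist (fun g => pi g == iota 1%g) _ (fibre_shift_subproof g).

Lemma fibre_shiftK (g : G) :
  g = sval (fibre_shift g) - sval e + ract (pi g) (sval e).
Proof. by rewrite /= addrK subrK. Qed.

(** As [r |-> r e] splits [pi], the map [g |-> g - pi(g) e] projects [G] onto the kernel. Translated
    by [e], it is a module morphism to the fibre with zero [e], as this lemma and the next
    express. *)
Lemma fibre_shiftD g h :
  fibre_shift (g + h) = br (fibre_shift g) e (fibre_shift h).
Proof.
apply: fibre_eq; rewrite /= (proj1 (svalP p)) ractDl opprD addrACA.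
by rewrite addrK [RHS]addrA.
Qed.

Lemma fibre_shift_act t g : fibre_shift (pact t g) = hact t e (fibre_shift g).
Proof.
apply: fibre_eq; rewrite /= (proj2 (svalP p)).
(* On [uring_module R], [pact t] is left multiplication by [iota t], which lets [ractM] match. *)
by rewrite -/(pact t (pi g)) ractM ract_map pactD addrK pactB.
Qed.

Lemma fibre_shift_id (a : fibre p) : fibre_shift (sval a) = a.
Proof. by apply: fibre_eq; rewrite /= fibreP ract_map pact1 subrK. Qed.
End Decomposition.

Lemma surjective_fibre_inh (X : slice_over_uring R) :
  surjective_over_uring X -> inhabited (fibre (slice_map X)).
Proof.
move=> /(_ (iota 1%g)) [g /eqP gP].
by exists; exact: (exist (fun g => sval (slice_map X) g == iota 1%g) g gP).
Qed.

Lemma fibre_zero_empty : fibre (slice_map (zero_over_uring R)) -> False.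
Proof. by move=> a; apply: (@uring_map1_neq0 T R); rewrite -(fibreP a). Qed.

Lemma fibre_functor_faithful : faithful Fib.
Proof.
move=> X Y f g fg; apply: slice_hom_eq; apply: concrete_hom_eq.
have fM := svalP (sval f); have gM := svalP (sval g).
have fgE (a : fibre (slice_map (sval X))) :
    sval (sval f) (sval a) = sval (sval g) (sval a).
  exact: (congr1 (fun h => sval (sval h a)) fg).
apply: funext => x; case: (svalP X) => [/surjective_fibre_inh[e]|X0].
  rewrite (fibre_shiftK e x) (proj1 fM) (proj1 gM).
  rewrite (upm_morphB fM) (upm_morphB gM).
  by rewrite (upm_morph_ract fM) (upm_morph_ract gM) !fgE.
(* Over the zero object the carrier has one element. *)
have -> : x = 0 by case: X X0 {f g fM gM fg fgE} x => X P /= ->; case.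
by rewrite (upm_morph0 fM) (upm_morph0 gM).
Qed.

Section Extension.
Variables (G H : unitalPointedModuleType T)
  (p : {f : G -> uring_module R | unital_pointed_module_morphism f})
  (q : {f : H -> uring_module R | unital_pointed_module_morphism f}).
Variables (h : fibre p -> fibre q) (e : fibre p).
Hypothesis hM : heap_of_modules_morphism h.

Definition fibre_extend (x : G) : H :=
  sval (h (fibre_shift e x)) - sval (h e) + ract (sval p x) (sval (h e)).

(** The map is [h], read with zeros [e] and [h e], on the kernel part, and [r e |-> r h(e)] on the
    complement. Additivity and equivariance of the first part come from [h] preserving the bracket
    and the action. *)
Lemma fibre_extend_morphism : unital_pointed_module_morphism fibre_extend.
Proof.
split=> [x y|t x]; rewrite /fibre_extend.
  rewrite fibre_shiftD (proj1 hM) (proj1 (svalP p)) ractDl /=.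
  by rewrite [RHS]addrACA -[X in X + _ = _]addrA.
rewrite fibre_shift_act (proj2 hM) (proj2 (svalP p)) /= addrK.
by rewrite -/(pact t _) ractM ract_map pactD pactB.
Qed.

(** Values of [h] lie in the fibre of [q], so under [q] the first two terms cancel and the third
    becomes [p(x) * iota 1]. *)
Lemma fibre_extend_over x : sval q (fibre_extend x) = sval p x.
Proof.
have qM := svalP q.
rewrite (proj1 qM) (upm_morphB qM) (upm_morph_ract qM) !fibreP subrr add0r.
by rewrite ract_uring uring_mul_map1.
Qed.

Lemma fibre_extendE (a : fibre p) : fibre_extend (sval a) = sval (h a).
Proof. by rewrite /fibre_extend fibre_shift_id fibreP ract_map pact1 subrK. Qed.
End Extension.

Lemma fibre_functor_full : full Fib.
Proof.
(* Only the source is split into cases: a point [e] of its fibre yields the base point [h e] of the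
   target fibre. *)
move=> X Y h; case: (svalP X) => [/surjective_fibre_inh[e]|X0].
  pose f : hom (slice_dom (sval X)) (slice_dom (sval Y)) :=
    exist _ _ (fibre_extend_morphism e (svalP h)).
  have fP : compc (slice_map (sval Y)) f = slice_map (sval X).
    apply: concrete_hom_eq; apply: funext => x; exact: fibre_extend_over.
  exists (exist _ f fP : hom X Y); apply: concrete_hom_eq; apply: funext => a.
  by apply: fibre_eq; apply: fibre_extendE.
case: X X0 h => X P /= X0; rewrite X0 in P *; move=> h.
(* From the zero object the lift is the zero map; it restricts to [h] because the source fibre is
   empty. *)
have zM : @unital_pointed_module_morphism T (zero_module T)
    (slice_dom (sval Y)) (fun=> 0).
  by split=> *; rewrite ?addr0 ?pact0.
pose f : hom (slice_dom (zero_over_uring R)) (slice_dom (sval Y)) :=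
  exist _ _ zM.
have fP : compc (slice_map (sval Y)) f = slice_map (zero_over_uring R).
  apply: concrete_hom_eq; apply: funext => x.
  exact: (upm_morph0 (svalP (slice_map (sval Y)))).
exists (exist _ f fP); apply: concrete_hom_eq; apply: funext => a.
by case: (fibre_zero_empty a).
Qed.

Section EssentiallySurjective.
Variables (M : heapOfModulesType T) (M_iso : isotropic M).

Definition split_extension (e : M) : slice_over_uring R :=
  @SliceObj (unital_pointed_modules T) (uring_object R)
    (prod_module (pointed_at M_iso e) (uring_module R))
    (exist _ _ (snd_morphism (pointed_at M_iso e) (uring_module R))).

Lemma split_extension_surj e : surjective_over_uring (split_extension e).
Proof. by move=> r; exists (0, r). Qed.

Definition to_fibre e (m : M) : fibre (slice_map (split_extension e)) :=
  exist (fun g => sval (slice_map (split_extension e)) g == iota 1%g)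
    (m : pointed_at M_iso e, iota 1%g) (eqxx (iota 1%g)).

Definition of_fibre e (a : fibre (slice_map (split_extension e))) : M :=
  (sval a).1.

Lemma of_fibreK e : cancel (@of_fibre e) (@to_fibre e).
Proof.
move=> a; apply: fibre_eq; move: (fibreP a); rewrite /of_fibre.
by case: (sval a) => m r /= ->.
Qed.

(** In the retract at [e], the fibre has bracket [a - b + c] and action [t n - t m + m]; [pt_brE]
    and change of base to [e] give the same formulas for [M]. *)
Lemma of_fibre_morphism e : heap_of_modules_morphism (@of_fibre e).
Proof.
split=> [a b c|t m n]; first by rewrite (pt_brE M_iso e).
by rewrite (hact_change t (of_fibre m) _ e) (pt_brE M_iso e).
Qed.

Lemma to_fibre_morphism e : heap_of_modules_morphism (@to_fibre e).
Proof.
have [ofB ofA] := of_fibre_morphism e.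
split=> [a b c|t m n]; apply: (can_inj (@of_fibreK e)).
  by rewrite ofB.
by rewrite ofA.
Qed.
End EssentiallySurjective.

Lemma fibre_functor_esurj : essentially_surjective Fib.
Proof.
move=> [M M_iso]; pose P (X : slice_over_uring R) :=
  surjective_over_uring X \/ X = zero_over_uring R.
(* Excluded middle decides whether [M] has a point, which then serves as base of the split
   extension. *)
have [[e]|M0] := EM (inhabited M).
  exists (exist P _ (or_introl (split_extension_surj M_iso e))).
  exists (exist _ _ (to_fibre_morphism M_iso e)).
  exists (exist _ _ (of_fibre_morphism M_iso e)).
  split; apply: concrete_hom_eq; apply: funext => a //.
  exact: of_fibreK.
have M0' (m : M) : False by apply: M0.
(* For empty [M] the zero object is taken: its fibre is empty too, so both maps and their laws are
   vacuous. *)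
exists (exist P _ (or_intror erefl)).
pose Z := zero_over_uring R.
pose u (m : M) : fibre (slice_map Z) := False_rect _ (M0' m).
pose v (a : fibre (slice_map Z)) : M := False_rect _ (fibre_zero_empty a).
have uM : heap_of_modules_morphism u by split=> [a|t a]; case: (M0' a).
have vM : heap_of_modules_morphism v.
  by split=> [a|t a]; case: (fibre_zero_empty a).
exists (exist _ u uM), (exist _ v vM).
split; apply: concrete_hom_eq; apply: funext => a.
  by case: (fibre_zero_empty a).
by case: (M0' a).
Qed.

End Equivalence.

Theorem theorem4p14 (T : unitalTrussType) (R : universal_ring T) :
  equivalent_categories (isotropic_heaps_of_modules T) (surjective_or_zero R).
Proof.
exact: equivalent_of_weak_inverse (@fibre_functor_faithful T R)
  (@fibre_functor_full T R) (@fibre_functor_esurj T R).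
Qed.
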